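(* Let $\mathbb{F}$ be a field and let $q\in\mathbb{F}^*$ be not a root of unity. Let $m,n$ be positive integers with $\gcd(m,n)=1$, and let $f:\mathbb{Z}\to\mathbb{F}^*$ satisfy $f(i+n)=qf(i)$ for all $i\in\mathbb{Z}$. Then the representation $\mathsf{V}^{m,n}_f$ of the quantum plane $\mathbb{F}_q[x,y]$ on $\mathbb{F}[t^{\pm1}]$, defined by $x.t^i=t^{i+n}$ and $y.t^i=f(i)t^{i-m}$ for all $i\in\mathbb{Z}$, is an irreducible representation of $\mathbb{F}_q[x,y]$.
   Context: $\mathbb{F}$ is a field of arbitrary characteristic, not necessarily algebraically closed, with group of units $\mathbb{F}^*$. The quantum plane is the unital associative algebra $\mathbb{F}_q[x,y]=\mathbb{F}\{x,y\}/(yx-qxy)$ with generators $x,y$ and relation $yx=qxy$. Representations are left modules. $\mathbb{F}[t^{\pm1}]$ is the space of Laurent polynomials in $t$. *)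

(* Defs.v *)
From HB Require Import structures.
From mathcomp Require Import all_boot all_algebra.
From mathcomp Require Import boolp classical_sets.
From mathcomp Require Import finmap.
From mathcomp.multinomials Require Import monalg.

Set Implicit Arguments.
Unset Strict Implicit.
Unset Printing Implicit Defensive.

Import GRing.Theory.
Local Open Scope ring_scope.
Local Open Scope quotient_scope.

Definition two_sided_ideal (R : pzRingType) (J : set R) : Prop :=
  [/\ J 0, forall u v, J u -> J v -> J (u - v),
      forall a u, J u -> J (a * u) & forall a u, J u -> J (u * a)].

(* Boolean via classical logic, because [Quotient.quot] takes a predicate. *)
Definition ideal_gen (R : pzRingType) (r : R) : {pred R} :=
  fun u => `[< forall J : set R, two_sided_ideal J -> J r -> J u >].

Section IdealGen.
Variables (R : pzRingType) (r : R).

Lemma ideal_genP u :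
  reflect (forall J : set R, two_sided_ideal J -> J r -> J u)
          (u \in ideal_gen r).
Proof. exact: asboolP. Qed.

Lemma ideal_gen_zmod_closed : zmod_closed (ideal_gen r).
Proof.
split; first by apply/ideal_genP => J [].
move=> u v /ideal_genP hu /ideal_genP hv; apply/ideal_genP => J hJ Jr.
by have [_ hB _ _] := hJ; apply: hB; [exact: hu | exact: hv].
Qed.

HB.instance Definition _ :=
  GRing.isZmodClosed.Build R (ideal_gen r) ideal_gen_zmod_closed.

Lemma mem_ideal_gen : r \in ideal_gen r.
Proof. by apply/ideal_genP. Qed.

Lemma ideal_genMl a u : u \in ideal_gen r -> a * u \in ideal_gen r.
Proof.
move=> /ideal_genP hu; apply/ideal_genP => J hJ Jr.
by have [_ _ hM _] := hJ; apply: hM; exact: hu.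
Qed.

Lemma ideal_genMr a u : u \in ideal_gen r -> u * a \in ideal_gen r.
Proof.
move=> /ideal_genP hu; apply/ideal_genP => J hJ Jr.
by have [_ _ _ hM] := hJ; apply: hM; exact: hu.
Qed.

End IdealGen.

(* The free algebra F{x, y}: the monoid algebra of the free monoid on two
   letters, with [false] standing for x and [true] for y. *)
Notation free_alg F := {malg F[{fmonom bool}]}.
Definition free_x (F : fieldType) : free_alg F := << fmu false >>.
Definition free_y (F : fieldType) : free_alg F := << fmu true >>.
Arguments free_x {F}.
Arguments free_y {F}.

Section QuantumPlane.
Variables (F : fieldType) (q : F).
Local Notation free_xy := (free_alg F).

Definition qrel : free_xy := free_y * free_x - q *: (free_x * free_y).

Definition qplane : Type := Quotient.quot (ideal_gen qrel).
HB.instance Definition _ := GRing.Zmodule.on qplane.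
HB.instance Definition _ := EqQuotient.on qplane.

Local Notation pi := (\pi_qplane : free_xy -> qplane).

Lemma qplane_eqP (a b : free_xy) :
  reflect (pi a = pi b) (a - b \in ideal_gen qrel).
Proof. by rewrite Quotient.idealrBE; apply: eqP. Qed.

Lemma qplane_piB (a b : free_xy) : pi (a - b) = pi a - pi b.
Proof. exact: (raddfB (\pi_(Quotient.quot (ideal_gen qrel)))). Qed.

Lemma qplane_piD (a b : free_xy) : pi (a + b) = pi a + pi b.
Proof. exact: (raddfD (\pi_(Quotient.quot (ideal_gen qrel)))). Qed.

Lemma qplane_pi0 : pi 0 = 0.
Proof. exact: (raddf0 (\pi_(Quotient.quot (ideal_gen qrel)))). Qed.

Definition qplane_one : qplane := pi 1.
Definition qplane_mul (u v : qplane) : qplane := pi (repr u * repr v).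

Lemma qplane_piM (a b : free_xy) : qplane_mul (pi a) (pi b) = pi (a * b).
Proof.
apply/qplane_eqP.
set a' := repr _; set b' := repr _.
have ha : a' - a \in ideal_gen qrel by apply/qplane_eqP; rewrite reprK.
have hb : b' - b \in ideal_gen qrel by apply/qplane_eqP; rewrite reprK.
have -> : a' * b' - a * b = (a' - a) * b' + a * (b' - b).
  by rewrite mulrBl mulrBr addrA subrK.
by apply: rpredD; [apply: ideal_genMr | apply: ideal_genMl].
Qed.

Lemma qplane_piP (u : qplane) : {a : free_xy | u = pi a}.
Proof. by exists (repr u); rewrite reprK. Qed.

Lemma qplane_mulA : associative qplane_mul.
Proof.
move=> u v w; have [a ->] := qplane_piP u.
have [b ->] := qplane_piP v; have [c ->] := qplane_piP w.
by rewrite !qplane_piM mulrA.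
Qed.

Lemma qplane_mul1 : left_id qplane_one qplane_mul.
Proof.
by move=> u; have [a ->] := qplane_piP u; rewrite qplane_piM mul1r.
Qed.

Lemma qplane_mulr1 : right_id qplane_one qplane_mul.
Proof.
by move=> u; have [a ->] := qplane_piP u; rewrite qplane_piM mulr1.
Qed.

Lemma qplane_mulDl : left_distributive qplane_mul +%R.
Proof.
move=> u v w; have [a ->] := qplane_piP u.
have [b ->] := qplane_piP v; have [c ->] := qplane_piP w.
by rewrite -qplane_piD !qplane_piM mulrDl qplane_piD.
Qed.

Lemma qplane_mulDr : right_distributive qplane_mul +%R.
Proof.
move=> u v w; have [a ->] := qplane_piP u.
have [b ->] := qplane_piP v; have [c ->] := qplane_piP w.
by rewrite -qplane_piD !qplane_piM mulrDr qplane_piD.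
Qed.

(* The ideal is proper: it lies in the kernel of the augmentation map. *)
Lemma qplane_oner_neq0 : qplane_one != 0.
Proof.
apply/eqP; rewrite /qplane_one -qplane_pi0 => /qplane_eqP /ideal_genP.
pose aug (a : free_xy) : F := mcoeff (mone : {fmonom bool}) a.
have augB a b : aug (a - b) = aug a - aug b by exact: mcoeffB.
have augM a b : aug (a * b) = aug a * aug b.
  exact: (mcoeff1g_is_multiplicative _ _).1.
have augx : aug free_x = 0.
  by rewrite /aug /free_x mcoeffU1 fmP fmU fm1.
move=> /(_ (fun a => aug a = 0)) H; have: aug (1 - 0) = 0.
  apply: H.
  - split=> [|u v hu hv|a u hu|a u hu]; first exact: mcoeff0.
    + by rewrite augB hu hv subr0.
    + by rewrite augM hu mulr0.
    + by rewrite augM hu mul0r.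
  - have augZ a : aug (q *: a) = q * aug a by exact: mcoeffZ.
    suff augr (x y : free_xy) : aug x = 0 -> aug (y * x - q *: (x * y)) = 0.
      exact: augr.
    move=> ax; rewrite (augB (y * x)) (augZ (x * y)) (augM y x) (augM x y) ax.
    by rewrite mulr0 mul0r mulr0 subr0.
by rewrite subr0 /aug mcoeff1 eqxx => /eqP; rewrite oner_eq0.
Qed.

HB.instance Definition _ := GRing.Zmodule_isNzRing.Build qplane
  qplane_mulA qplane_mul1 qplane_mulr1 qplane_mulDl qplane_mulDr
  qplane_oner_neq0.

Lemma qplane_pi_mul (a b : free_xy) : pi (a * b) = pi a * pi b.
Proof. by rewrite -qplane_piM. Qed.

Definition qplane_scale (c : F) (u : qplane) : qplane := pi (malgC c) * u.

Lemma qplane_scaleE c (a : free_xy) : qplane_scale c (pi a) = pi (c *: a).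
Proof. by rewrite /qplane_scale -qplane_pi_mul mul_malgC. Qed.

Lemma qplane_scaleA c d u :
  qplane_scale c (qplane_scale d u) = qplane_scale (c * d) u.
Proof. by have [a ->] := qplane_piP u; rewrite !qplane_scaleE scalerA. Qed.

Lemma qplane_scale1 : left_id 1 qplane_scale.
Proof.
by move=> u; have [a ->] := qplane_piP u; rewrite !qplane_scaleE scale1r.
Qed.

Lemma qplane_scaleDr : right_distributive qplane_scale +%R.
Proof. by move=> c u v; rewrite /qplane_scale mulrDr. Qed.

Lemma qplane_scaleDl u : {morph qplane_scale^~ u : c d / c + d}.
Proof.
move=> c d; have [a ->] := qplane_piP u.
by rewrite !qplane_scaleE scalerDl qplane_piD.
Qed.

HB.instance Definition _ := GRing.Zmodule_isLmodule.Build F qplane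
  qplane_scaleA qplane_scale1 qplane_scaleDr qplane_scaleDl.

Lemma qplane_scaleAl (c : F) (u v : qplane) : c *: (u * v) = (c *: u) * v.
Proof. exact: mulrA. Qed.

HB.instance Definition _ :=
  GRing.Lmodule_isLalgebra.Build F qplane qplane_scaleAl.

Lemma qplane_scaleAr (c : F) (u v : qplane) : c *: (u * v) = u * (c *: v).
Proof.
have [a ->] := qplane_piP u; have [b ->] := qplane_piP v.
have piZ d (e : free_xy) : d *: pi e = pi (d *: e) by exact: qplane_scaleE.
rewrite -qplane_pi_mul !piZ -qplane_pi_mul; congr pi.
have cC : malgC c * a = a * malgC c.
  rewrite mul_malgC malgM_def fgmulgU malgZ_def; apply: eq_bigr => k _.
  by rewrite mulm1 mulrC.
transitivity (malgC c * a * b); first by rewrite mul_malgC -scalerAl.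
by rewrite cC -[LHS]mulrA mul_malgC.
Qed.

HB.instance Definition _ :=
  GRing.Lalgebra_isAlgebra.Build F qplane qplane_scaleAr.

Definition qx : qplane := pi free_x.
Definition qy : qplane := pi free_y.

Lemma qplane_piZ c (a : free_xy) : pi (c *: a) = c *: pi a.
Proof. by rewrite -qplane_scaleE. Qed.

Lemma qplane_yx : qy * qx = q *: (qx * qy).
Proof.
rewrite /qx /qy -!qplane_pi_mul -qplane_piZ.
by apply/qplane_eqP; exact: mem_ideal_gen.
Qed.

End QuantumPlane.

Definition malg_lift (F : fieldType) (K : choiceType) (V : lmodType F)
    (h : K -> V) (g : {malg F[K]}) : V :=
  \sum_(k <- msupp g) g@_k *: h k.

Section MalgLift.
Variables (F : fieldType) (K : choiceType) (V : lmodType F) (h : K -> V).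

Lemma malg_liftEw (d : {fset K}) (g : {malg F[K]}) : (msupp g `<=` d)%fset ->
  malg_lift h g = \sum_(k <- d) g@_k *: h k.
Proof.
move=> le; rewrite /malg_lift (big_fset_incl _ le) => //= k _.
by move=> /mcoeff_outdom ->; rewrite scale0r.
Qed.

Lemma malg_lift_is_linear : linear (malg_lift h).
Proof.
move=> c g1 g2; pose d := (msupp g1 `|` msupp g2)%fset.
have h1 : (msupp g1 `<=` d)%fset by exact: fsubsetUl.
have h2 : (msupp g2 `<=` d)%fset by exact: fsubsetUr.
have h12 : (msupp (c *: g1 + g2) `<=` d)%fset.
  apply: fsubset_trans (msuppD_le _ _) _; rewrite fsubUset h2 andbT.
  exact: fsubset_trans (msuppZ_le _ _) h1.
rewrite (malg_liftEw h1) (malg_liftEw h2) (malg_liftEw h12).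
rewrite scaler_sumr -big_split; apply: eq_bigr => k _ /=.
by rewrite mcoeffD mcoeffZ scalerDl scalerA.
Qed.

HB.instance Definition _ :=
  GRing.isLinear.Build F {malg F[K]} V *:%R (malg_lift h) malg_lift_is_linear.

Lemma malg_liftU c k : malg_lift h << c *g k >> = c *: h k.
Proof. by rewrite (malg_liftEw msuppU_le) big_seq_fset1 mcoeffUU. Qed.

Lemma malg_linear_ext (h1 h2 : {linear {malg F[K]} -> V}) :
  (forall k, h1 << k >> = h2 << k >>) -> h1 =1 h2.
Proof.
move=> eq_h g; rewrite (monalgE g) !linear_sum; apply: eq_bigr => k _.
have -> : << g@_k *g k >> = g@_k *: << k >>.
  by apply/malgP => k'; rewrite mcoeffZ !mcoeffU mulr_natr.
by rewrite !linearZ eq_h.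
Qed.

End MalgLift.

(* Endomorphisms X, Y of a vector space V with Y X = q X Y make V a left module
   over the quantum plane, x acting as X and y as Y. *)
Section QPlaneModule.
Variables (F : fieldType) (q : F) (V : lmodType F) (X Y : {linear V -> V}).
Hypothesis YX : forall v, Y (X v) = q *: X (Y v).

Definition word_act (w : {fmonom bool}) (v : V) : V :=
  foldr (fun b u => if b then Y u else X u) v w.

Definition free_act (a : free_alg F) (v : V) : V :=
  malg_lift (word_act^~ v) a.

Lemma word_act_linear w : linear (word_act w).
Proof.
move=> c u v; rewrite /word_act; elim: (w : seq bool) => //= b s ->.
by case: b; rewrite linearP.
Qed.

HB.instance Definition _ w :=
  GRing.isLinear.Build F V V *:%R (word_act w) (word_act_linear w).

Lemma word_actM w1 w2 v :
  word_act (mmul w1 w2) v = word_act w1 (word_act w2 v).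
Proof. by rewrite /word_act fmM foldr_cat. Qed.

Lemma free_act_linear a : linear (free_act a).
Proof.
move=> c u v; rewrite /free_act /malg_lift scaler_sumr -big_split.
by apply: eq_bigr => w _ /=; rewrite linearP scalerDr !scalerA mulrC.
Qed.

HB.instance Definition _ a :=
  GRing.isLinear.Build F V V *:%R (free_act a) (free_act_linear a).

Lemma free_actBl a b v : free_act (a - b) v = free_act a v - free_act b v.
Proof. exact: linearB. Qed.

Lemma free_actDl a b v : free_act (a + b) v = free_act a v + free_act b v.
Proof. exact: linearD. Qed.

Lemma free_actZl c a v : free_act (c *: a) v = c *: free_act a v.
Proof. exact: linearZ. Qed.

Lemma free_actM a b v : free_act (a * b) v = free_act a (free_act b v).
Proof.
rewrite malgME [LHS](linear_sum (malg_lift (word_act^~ v))) /=.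
transitivity (\sum_(w1 <- msupp a) a@_w1 *: word_act w1 (free_act b v)) => //.
apply: eq_bigr => w1 _; rewrite linear_sum /= [in RHS]/free_act [in RHS]/malg_lift.
rewrite (linear_sum (word_act w1)) scaler_sumr; apply: eq_bigr => w2 _ /=.
by rewrite malg_liftU word_actM linearZ scalerA.
Qed.

Lemma free_act1 v : free_act 1 v = v.
Proof. by rewrite /free_act malg_liftU scale1r /word_act fm1. Qed.

Lemma free_act_x v : free_act free_x v = X v.
Proof. by rewrite /free_act malg_liftU scale1r /word_act fmU. Qed.

Lemma free_act_y v : free_act free_y v = Y v.
Proof. by rewrite /free_act malg_liftU scale1r /word_act fmU. Qed.

Lemma free_act_ideal a v : a \in ideal_gen (qrel q) -> free_act a v = 0.
Proof.
move=> /ideal_genP /(_ (fun a => forall v, free_act a v = 0)); apply.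
  split=> [u|a1 a2 h1 h2 u|b a1 h u|b a1 h u]; first exact: linear0.
  - by rewrite free_actBl h1 h2 subr0.
  - by rewrite free_actM h linear0.
  - by rewrite free_actM h.
suff act_rel (x y : free_alg F) : free_act x =1 X -> free_act y =1 Y ->
    forall u, free_act (y * x - q *: (x * y)) u = 0.
  by apply: act_rel; [exact: free_act_x | exact: free_act_y].
move=> hx hy u; rewrite free_actBl free_actZl !free_actM !(hx, hy).
by rewrite YX subrr.
Qed.

Definition qplane_act (a : qplane q) (v : V) : V := free_act (repr a) v.

Lemma qplane_act_pi a v : qplane_act (\pi a) v = free_act a v.
Proof.
apply/eqP; rewrite -subr_eq0 -free_actBl free_act_ideal //.
by apply/qplane_eqP; rewrite reprK.
Qed.

Lemma qplane_actA a b v :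
  qplane_act a (qplane_act b v) = qplane_act (a * b) v.
Proof.
have [a' ->] := qplane_piP a; have [b' ->] := qplane_piP b.
by rewrite -qplane_pi_mul !qplane_act_pi free_actM.
Qed.

Lemma qplane_act1 : left_id 1 qplane_act.
Proof. by move=> v; rewrite qplane_act_pi free_act1. Qed.

Lemma qplane_actDr : right_distributive qplane_act +%R.
Proof. by move=> a u v; exact: linearD. Qed.

Lemma qplane_actDl v : {morph qplane_act^~ v : a b / a + b}.
Proof.
move=> a b; have [a' ->] := qplane_piP a; have [b' ->] := qplane_piP b.
by rewrite -qplane_piD !qplane_act_pi free_actDl.
Qed.

(* The carrier is V; the proof of Y X = q X Y is a parameter of the type so that
   the module structure can be inferred from it. *)
Definition qplane_module of (forall v, Y (X v) = q *: X (Y v)) : Type := V.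

HB.instance Definition _ := GRing.Zmodule.on (qplane_module YX).
HB.instance Definition _ := GRing.Zmodule_isLmodule.Build (qplane q)
  (qplane_module YX) qplane_actA qplane_act1 qplane_actDr qplane_actDl.

Lemma qplane_module_x (v : qplane_module YX) : qx q *: v = X v.
Proof. by rewrite -free_act_x; exact: qplane_act_pi. Qed.

Lemma qplane_module_y (v : qplane_module YX) : qy q *: v = Y v.
Proof. by rewrite -free_act_y; exact: qplane_act_pi. Qed.

Lemma qplane_module_scalar (c : F) (v : qplane_module YX) :
  (c%:A : qplane q) *: v = c *: (v : V).
Proof.
have -> : c%:A = \pi_(qplane q) (c *: 1 : free_alg F) by rewrite qplane_piZ.
by rewrite -[in RHS](free_act1 v) -free_actZl; exact: qplane_act_pi.
Qed.

End QPlaneModule.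

(* The space of Laurent polynomials, with basis t^i = << i >>, i : int. *)
Notation laurent F := {malg F[int]}.

Section VRepresentation.
Variables (F : fieldType) (q : F) (m n : nat) (f : int -> F).

Definition lx : laurent F -> laurent F :=
  malg_lift (fun i : int => << i + n%:Z >>).
Definition ly : laurent F -> laurent F :=
  malg_lift (fun i : int => f i *: << i - m%:Z >>).

HB.instance Definition _ := GRing.isLinear.Build F (laurent F) (laurent F)
  *:%R lx (malg_lift_is_linear _).
HB.instance Definition _ := GRing.isLinear.Build F (laurent F) (laurent F)
  *:%R ly (malg_lift_is_linear _).

Lemma lxU c i : lx << c *g i >> = c *: << i + n%:Z >>.
Proof. exact: malg_liftU. Qed.

Lemma lyU c i : ly << c *g i >> = c *: (f i *: << i - m%:Z >>).
Proof. exact: malg_liftU. Qed.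

Hypothesis hf : forall i : int, f (i + n%:Z) = q * f i.

Lemma lyx g : ly (lx g) = q *: lx (ly g).
Proof.
apply: (malg_linear_ext (h1 := ly \o lx) (h2 := q \*: (lx \o ly))) => i /=.
rewrite lxU lyU !linearZ /= lxU lyU !scale1r hf addrAC !scalerA.
by rewrite (mulrC q).
Qed.

Definition V_rep : lmodType (qplane q) := qplane_module lyx.

Definition V_t (i : int) : V_rep := (<< i >> : laurent F).

(* x.t^i = t^(i+n) and y.t^i = f(i) t^(i-m); the scalar f(i) acts through the
   embedding of F in the quantum plane, see [qplane_module_scalar]. *)
Lemma V_rep_x i : qx q *: V_t i = V_t (i + n%:Z).
Proof. by rewrite qplane_module_x /= lxU scale1r. Qed.

Lemma V_rep_y i : qy q *: V_t i = (f i)%:A *: V_t (i - m%:Z).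
Proof.
rewrite qplane_module_y /= lyU scale1r.
by rewrite qplane_module_scalar.
Qed.

End VRepresentation.
Arguments V_rep {F q} m {n f} hf.

(* For a set U, [mem U] is classical membership, so U ranges over all
   submodules and not only the decidable ones. *)
Definition irreducible (A : pzRingType) (V : lmodType A) : Prop :=
  (exists v : V, v != 0) /\
  forall U : set V, submod_closed (mem U) -> U = [set 0]%classic \/ U = setT.

(* Main.v *)
Require Import Defs.
From mathcomp Require Import all_boot all_algebra.
From HB Require Import structures.
From mathcomp Require Import order boolp classical_sets finmap zify.
From mathcomp.multinomials Require Import monalg.

(** The operator x^m y^n fixes every line F t^i: it multiplies t^i by the
    weight lambda(i) = f(i) f(i - m) ... f(i - (n - 1) m).  Shifting i by m
    telescopes this product, and f(j + n m) = q^m f(j), so that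
    lambda(i + m) = q^m lambda(i); shifting i by n multiplies each of the n
    factors by q, so that lambda(i + n) = q^n lambda(i).  As m and n are
    coprime, Bezout gives lambda(i + 1) = q lambda(i) ([weightS]), and the
    weights are pairwise distinct because q is not a root of unity
    ([weight_inj]).

    A subspace stable under a diagonal operator with distinct eigenvalues
    contains every basis vector that occurs in one of its elements
    ([diagonal_stable]), so a nonzero submodule contains some t^i.  Up to nonzero
    scalars, x^a y^b moves t^i to t^(i + a n - b m), and every integer has the
    form a n - b m with a and b nonnegative ([int_comb]); hence the submodule
    contains all t^j. *)

Set Implicit Arguments.
Unset Strict Implicit.
Unset Printing Implicit Defensive.

Import Order.TTheory GRing.Theory.
Local Open Scope ring_scope.

Section IterLinear.
Variables (R : pzRingType) (V : lmodType R) (h : {linear V -> V}).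

Lemma iter_is_linear k : linear (iter k h).
Proof. by move=> c u v; elim: k => //= k ->; rewrite linearP. Qed.

HB.instance Definition _ k :=
  GRing.isLinear.Build R V V *:%R (iter k h) (iter_is_linear k).

End IterLinear.

(** The shift by s is to be realized by a monomial x^a y^b, and x and y are not
    invertible in the quantum plane: hence the nonnegative a and b, which Bezout
    provides for s = 1 and s = - 1, whence for all s by scaling. *)
Lemma int_comb (m n : nat) (s : int) : (0 < m)%N -> (0 < n)%N -> coprime m n ->
  exists a b : nat, s = (a * n)%:Z - (b * m)%:Z.
Proof.
move=> m_gt0 n_gt0 /eqP co_mn; case: (intP s) => [|k|k].
- by exists 0%N, 0%N.
- case: (egcdnP m n_gt0) => u v; rewrite gcdnC co_mn => uv _.
  by exists (k.+1 * u)%N, (k.+1 * v)%N; rewrite -!mulnA uv; lia.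
- case: (egcdnP n m_gt0) => u v; rewrite co_mn => uv _.
  by exists (k.+1 * v)%N, (k.+1 * u)%N; rewrite -!mulnA uv; lia.
Qed.

Section Diagonal.
Variables (F : fieldType) (K : choiceType).
Implicit Types (g : {malg F[K]}) (k : K).

Lemma malgU_scale c k : << c *g k >> = c *: << k >> :> {malg F[K]}.
Proof. by apply/malgP => k'; rewrite mcoeffZ !mcoeffU mulr_natr. Qed.

Lemma malg_sum_scale g : g = \sum_(k <- msupp g) g@_k *: << k >>.
Proof.
by rewrite [LHS]monalgE; apply: eq_bigr => k _; rewrite malgU_scale.
Qed.

Variables (T : {linear {malg F[K]} -> {malg F[K]}}) (lam : K -> F).
Hypothesis T_diag : forall k, T << k >> = lam k *: << k >>.

Lemma mcoeff_diagonal g k : (T g)@_k = lam k * g@_k.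
Proof.
rewrite [g in LHS]malg_sum_scale linear_sum [g in RHS]malg_sum_scale /=.
rewrite !raddf_sum mulr_sumr; apply: eq_bigr => j _ /=.
rewrite linearZ /= T_diag !mcoeffZ !mcoeffU.
by case: eqP => [->|_]; rewrite ?mulr0n ?mulr0 // mulrCA.
Qed.

(** For j in the support of g, the vector T g - lam j *: g has the support of g
    with j removed, so all terms but the one at k can be eliminated in turn. *)
Lemma diagonal_stable (W : {pred {malg F[K]}}) : injective lam ->
  submod_closed W -> {homo T : g / g \in W} ->
  forall g k, g \in W -> g@_k != 0 -> << k >> \in W.
Proof.
move=> lam_inj [W0 W_lin] WT g k.
have WZ c u : u \in W -> c *: u \in W by move=> Wu; rewrite -[_ *: _]addr0 W_lin.
have [N] := ubnP #|` msupp g|; elim: N g => // N IH g; rewrite ltnS => sz_g Wg gk.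
have [/existsP[[j j_supp] /= jk]|/existsPn only_k] :=
  boolP [exists j : msupp g, fsval j != k].
- set g' := T g - lam j *: g.
  have g'E i : g'@_i = (lam i - lam j) * g@_i.
    by rewrite mcoeffB mcoeffZ mcoeff_diagonal mulrBl.
  apply: (IH g'); last 1 first.
  + by rewrite g'E mulf_neq0 // subr_eq0 inj_eq // eq_sym.
  + apply: leq_trans sz_g; apply: fproper_ltn_card; apply/andP; split.
      apply/fsubsetP => i; rewrite -!mcoeff_neq0 g'E.
      by apply: contra_neq => ->; rewrite mulr0.
    apply: contraTN j_supp => /fsubsetP sub; apply/negP => /sub.
    by rewrite -mcoeff_neq0 g'E subrr mul0r eqxx.
  + by rewrite /g' addrC -scaleNr W_lin ?WT.
- have gE : g = g@_k *: << k >>.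
    apply/malgP => i; rewrite mcoeffZ mcoeffU; case: (eqVneq k i) => [->|ki].
      by rewrite mulr1.
    rewrite mulr0; apply/eqP; rewrite mcoeff_eq0; apply/negP => i_supp.
    by have := only_k [` i_supp]%fset; rewrite /= eq_sym ki.
  by rewrite -[<< k >>](scalerK gk) WZ // -gE.
Qed.

End Diagonal.

Section Weights.
Variables (F : fieldType) (q : F) (m n : nat) (f : int -> F).
Hypothesis hf : forall i : int, f (i + n%:Z) = q * f i.

Lemma f_addM k i : f (i + (k * n)%:Z) = q ^+ k * f i.
Proof.
elim: k => [|k IH]; first by rewrite mul0n addr0 mul1r.
rewrite exprS -mulrA -IH -hf; congr f; lia.
Qed.

Definition weight (i : int) : F := \prod_(k < n) f (i - (k * m)%:Z).

Lemma iter_lxU a i : iter a (lx n) << i >> = << i + (a * n)%:Z >> :> laurent F.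
Proof.
elim: a => [|a IH]; first by rewrite mul0n addr0.
by rewrite iterS IH lxU scale1r; congr << _ >>; lia.
Qed.

Lemma iter_lyU b i : iter b (ly m f) << i >> =
  (\prod_(k < b) f (i - (k * m)%:Z)) *: << i - (b * m)%:Z >>.
Proof.
elim: b => [|b IH]; first by rewrite big_ord0 scale1r mul0n subr0.
rewrite iterS IH linearZ /= lyU scale1r scalerA big_ord_recr /=.
by congr (_ *: << _ >>); lia.
Qed.

Lemma weight_op i :
  iter m (lx n) (iter n (ly m f) << i >>) = weight i *: << i >>.
Proof.
by rewrite iter_lyU linearZ /= iter_lxU; congr (_ *: << _ >>); lia.
Qed.

Lemma weightDn i : weight (i + n%:Z) = q ^+ n * weight i.
Proof.
rewrite /weight -[X in q ^+ X]card_ord -prodr_const -big_split /=.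
by apply: eq_bigr => k _; rewrite -hf; congr f; lia.
Qed.

Hypothesis hf0 : forall i, f i != 0.

Lemma weight_neq0 i : weight i != 0.
Proof. exact/prodf_neq0. Qed.

(** The product of the n + 1 values f (i + m - k m), 0 <= k <= n, is
    weight (i + m) times its last factor and also weight i times its first
    factor f (i + m), which is q ^+ m times the last one. *)
Lemma weightDm i : weight (i + m%:Z) = q ^+ m * weight i.
Proof.
apply: (mulIf (hf0 (i + m%:Z - (n * m)%:Z))).
transitivity (\prod_(k < n.+1) f (i + m%:Z - (k * m)%:Z)).
  by rewrite big_ord_recr.
rewrite big_ord_recl mul0n subr0 [LHS]mulrC [q ^+ m * _]mulrC -mulrA; congr (_ * _).
  by apply: eq_bigr => k _; congr f; rewrite /= /bump /=; lia.
by rewrite -f_addM; congr f; lia.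
Qed.

Hypotheses (hq0 : q != 0) (hm : (0 < m)%N) (hmn : coprime m n).

Lemma weightS i : weight (i + 1) = q * weight i.
Proof.
case: (egcdnP n hm) => u v; rewrite (eqP hmn) => uv _.
have wDn k j : weight (j + (k * n)%:Z) = q ^+ (k * n) * weight j.
  elim: k => [|k IH]; first by rewrite mul0n addr0 mul1r.
  rewrite mulSn exprD -mulrA -IH -weightDn; congr weight; lia.
have wDm k j : weight (j + (k * m)%:Z) = q ^+ (k * m) * weight j.
  elim: k => [|k IH]; first by rewrite mul0n addr0 mul1r.
  rewrite mulSn exprD -mulrA -IH -weightDm; congr weight; lia.
(* As u m = v n + 1, the points i + u m and (i + 1) + v n coincide. *)
apply: (mulfI (expf_neq0 (v * n) hq0)).
by rewrite -wDn mulrA -exprSr -addn1 -uv -wDm uv; congr weight; lia.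
Qed.

Lemma weight_inj : (forall k : nat, (0 < k)%N -> ~~ k.-unity_root q) ->
  injective weight.
Proof.
move=> hq; have wD k i : weight (i + k%:Z) = q ^+ k * weight i.
  elim: k => [|k IH]; first by rewrite addr0 mul1r.
  by rewrite exprS -mulrA -IH -weightS; congr weight; lia.
have lt_neq i j : i < j -> weight i <> weight j.
  move=> ij; have -> : j = i + `|j - i|%N%:Z by lia.
  rewrite wD -[LHS]mul1r => /(mulIf (weight_neq0 i)) /esym/eqP.
  by rewrite -unity_rootE; apply/negP/hq; lia.
move=> i j wij; case: (ltgtP i j) => // [/lt_neq|/lt_neq]; rewrite wij //.
Qed.

End Weights.

Theorem proposition2p3 (F : fieldType) (q : F)
    (hq0 : q != 0)
    (hq : forall k : nat, (0 < k)%N -> ~~ k.-unity_root q)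
    (m n : nat) (hm : (0 < m)%N) (hn : (0 < n)%N) (hmn : coprime m n)
    (f : int -> F) (hf0 : forall i : int, f i != 0)
    (hf : forall i : int, f (i + n%:Z) = q * f i) :
  irreducible (V_rep m hf).
Proof.
split.
  exists (V_t m hf 0); apply/eqP => /(congr1 (fun g : laurent F => g@_0)).
  by rewrite mcoeffUU mcoeff0 => /eqP; rewrite oner_eq0.
move=> U [U0 U_lin].
pose W : {pred laurent F} := mem U.
have WZq (a : qplane q) (u : V_rep m hf) : u \in U -> a *: u \in U.
  by move=> Uu; rewrite -[_ *: _]addr0; apply: U_lin.
have W_sub : submod_closed W.
  split=> // c u v Wu Wv.
  have := U_lin c%:A u v Wu Wv.
  by rewrite qplane_module_scalar.
have Wx a : {homo iter a (lx n) : g / g \in W}.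
  move=> g Wg; elim: a => //= a IH.
  by have := WZq (qx q) _ IH; rewrite qplane_module_x.
have Wy b : {homo iter b (ly m f) : g / g \in W}.
  move=> g Wg; elim: b => //= b IH.
  by have := WZq (qy q) _ IH; rewrite qplane_module_y.
have [[g Wg g0]|U_triv] := pselect (exists2 g : laurent F, g \in W & g != 0);
  last first.
  left; apply/seteqP; split=> [g Ug|_ ->]; last by rewrite -in_setE.
  by apply: contrapT => /eqP g0; apply: U_triv; exists g; rewrite ?in_setE.
right; apply/seteqP; split=> // h _; rewrite -in_setE -[_ \in _]/(h \in W).
have [i gi] : exists i, g@_i != 0.
  apply: contrapT => gE; move/eqP: g0; apply; apply/malgP => i; rewrite mcoeff0.
  by apply: contrapT => /eqP gi; apply: gE; exists i.
have Wi : << i >> \in W.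
  apply: (diagonal_stable (T := iter m (lx n) \o iter n (ly m f))) Wg gi => //.
  - exact: weight_op.
  - exact: (weight_inj hf hf0 hq0 hm hmn hq).
  - by move=> u Wu; apply/Wx/Wy.
have [W0 W_lin] := W_sub.
have WZ c u : u \in W -> c *: u \in W.
  by move=> Wu; rewrite -[_ *: _]addr0 W_lin.
have Wall j : << j >> \in W.
  have [a [b jE]] := int_comb (j - i) hm hn hmn.
  have := Wx a _ (Wy b _ Wi); rewrite iter_lyU linearZ /= iter_lxU.
  have -> : i - (b * m)%:Z + (a * n)%:Z = j by lia.
  move=> /(WZ (\prod_(k < b) f (i - (k * m)%:Z))^-1).
  by rewrite scalerK //; apply/prodf_neq0.
rewrite (malg_sum_scale h); elim/big_ind: _ => // [u v Wu Wv|j _].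
- by rewrite -[u]scale1r W_lin.
- exact: WZ.
Qed.
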